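(* Let $\mathsf T$ be an essentially small triangulated category. If $\mathsf T$ is finitely generated and locally finite, then $\mathsf T$ has only finitely many thick subcategories.
   Context: An essentially small triangulated category $\mathsf T$ is locally noetherian if every cohomological functor $\mathsf T^{\mathrm{op}}\to\mathsf{Ab}$ is a direct sum of representable functors; it is locally finite if both $\mathsf T$ and $\mathsf T^{\mathrm{op}}$ are locally noetherian. A thick subcategory is a full triangulated subcategory closed under direct summands. $\mathsf T$ is finitely generated if there is an object $X$ such that the smallest thick subcategory $\mathrm{Thick}(X)$ of $\mathsf T$ containing $X$ equals $\mathsf T$. *)

(* Defs.v *)
From HB Require Import structures.
From mathcomp Require Import all_boot all_algebra.
From mathcomp Require Import boolp classical_sets functions cardinality.

Set Implicit Arguments.
Unset Strict Implicit.
Unset Printing Implicit Defensive.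

Import GRing.Theory.
Local Open Scope classical_set_scope.
Local Open Scope ring_scope.

(* The category Ab is [zmodType].  A "set" is a type in the universe of the
   carriers of [zmodType]; the objects of a category may live in a larger
   universe, so that [essentially_small] below is a genuine condition. *)
Definition smallType := Type@{Algebra.Zmodule.axioms_.u0}.

Record preaddCat := PreaddCat {
  obj :> Type;
  mor : obj -> obj -> zmodType;
  idm : forall X, mor X X;
  mcomp : forall X Y Z, mor Y Z -> mor X Y -> mor X Z;
  mcompA : forall X Y Z W (h : mor Z W) (g : mor Y Z) (f : mor X Y),
    mcomp h (mcomp g f) = mcomp (mcomp h g) f;
  mcomp1m : forall X Y (f : mor X Y), mcomp (idm Y) f = f;
  mcompm1 : forall X Y (f : mor X Y), mcomp f (idm X) = f;
  mcompDl : forall X Y Z (g g' : mor Y Z) (f : mor X Y),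
    mcomp (g + g') f = mcomp g f + mcomp g' f;
  mcompDr : forall X Y Z (g : mor Y Z) (f f' : mor X Y),
    mcomp g (f + f') = mcomp g f + mcomp g f' }.

Arguments mor {p} X Y.
Arguments idm {p} X.
Arguments mcomp {p X Y Z} g f.

Notation "g ∘ f" := (mcomp g f) (at level 40, left associativity) : ring_scope.

Definition opCat (C : preaddCat) : preaddCat :=
  @PreaddCat C (fun X Y => @mor C Y X) (@idm C) (fun X Y Z g f => f ∘ g)
    (fun X Y Z W h g f => esym (mcompA f g h))
    (fun X Y f => mcompm1 f) (fun X Y f => mcomp1m f)
    (fun X Y Z g g' f => mcompDr f g g') (fun X Y Z g f f' => mcompDl f f' g).

Section Category.
Variable C : preaddCat.

Definition is_iso (X Y : C) (f : mor X Y) : Prop :=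
  exists g : mor Y X, g ∘ f = idm X /\ f ∘ g = idm Y.

Definition isomorphic (X Y : C) : Prop := exists f : mor X Y, is_iso f.

Definition is_zero (X : C) : Prop := idm X = 0.

Definition is_biproduct (X Y P : C) (i : mor X P) (j : mor Y P)
    (p : mor P X) (q : mor P Y) : Prop :=
  [/\ p ∘ i = idm X, q ∘ j = idm Y, q ∘ i = 0, p ∘ j = 0
    & i ∘ p + j ∘ q = idm P].

Definition additive_category : Prop :=
  (exists Z : C, is_zero Z) /\
  (forall X Y : C, exists P : C, exists i j p q, @is_biproduct X Y P i j p q).

Definition direct_summand (X Y : C) : Prop :=
  exists X' : C, exists i j p q, @is_biproduct X X' Y i j p q.

Definition essentially_small : Prop :=
  exists (I : smallType) (X : I -> C), forall Y, exists i, isomorphic Y (X i).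

End Category.

Record addEndo (C : preaddCat) := AddEndo {
  eobj :> C -> C;
  emap : forall X Y, mor X Y -> mor (eobj X) (eobj Y);
  emap1 : forall X, emap (idm X) = idm (eobj X);
  emapM : forall X Y Z (g : mor Y Z) (f : mor X Y),
    emap (g ∘ f) = emap g ∘ emap f;
  emapD : forall X Y (f g : mor X Y), emap (f + g) = emap f + emap g }.

Arguments emap {C} a {X Y} f.

Definition opEndo (C : preaddCat) (F : addEndo C) : addEndo (opCat C) :=
  @AddEndo (opCat C) F (fun X Y f => @emap C F Y X f) (fun X => emap1 F X)
    (fun X Y Z g f => emapM F f g) (fun X Y f g => emapD F f g).

(* The data of a triangulated category, without its axioms: an additive
   autoequivalence Sigma with a quasi-inverse, and a class of triangles. *)
Record triData := TriData {
  tcat :> preaddCat;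
  shift : addEndo tcat;
  unshift : addEndo tcat;
  shift_counit : forall X : tcat, mor (shift (unshift X)) X;
  shift_counit_iso : forall X, is_iso (shift_counit X);
  shift_counit_nat : forall (X Y : tcat) (f : mor X Y),
    f ∘ shift_counit X = shift_counit Y ∘ emap shift (emap unshift f);
  shift_unit : forall X : tcat, mor X (unshift (shift X));
  shift_unit_iso : forall X, is_iso (shift_unit X);
  shift_unit_nat : forall (X Y : tcat) (f : mor X Y),
    shift_unit Y ∘ f = emap unshift (emap shift f) ∘ shift_unit X;
  exact_triangle : forall X Y Z : tcat,
    mor X Y -> mor Y Z -> mor Z (shift X) -> Prop }.

Arguments shift {t}.
Arguments unshift {t}.
Arguments shift_counit {t} X.
Arguments shift_unit {t} X.
Arguments exact_triangle {t X Y Z} f g h.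

Notation "'Σ' X" := (eobj shift X) (at level 10, X at level 9) : ring_scope.
Notation "'Σm' f" := (emap shift f) (at level 10, f at level 9) : ring_scope.

Record is_triangulated (T : triData) : Prop := IsTriangulated {
  tri_additive : additive_category T;
  tri_iso : forall (X Y Z X' Y' Z' : T)
      (f : mor X Y) (g : mor Y Z) (h : mor Z (Σ X))
      (f' : mor X' Y') (g' : mor Y' Z') (h' : mor Z' (Σ X'))
      (u : mor X X') (v : mor Y Y') (w : mor Z Z'),
    is_iso u -> is_iso v -> is_iso w ->
    v ∘ f = f' ∘ u -> w ∘ g = g' ∘ v -> Σm u ∘ h = h' ∘ w ->
    exact_triangle f g h -> exact_triangle f' g' h';
  tri_id : forall X Z : T, is_zero Z ->
    exact_triangle (idm X) (0 : mor X Z) (0 : mor Z (Σ X));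
  tri_cone : forall (X Y : T) (f : mor X Y),
    exists (Z : T) (g : mor Y Z) (h : mor Z (Σ X)), exact_triangle f g h;
  tri_rot : forall (X Y Z : T) (f : mor X Y) (g : mor Y Z) (h : mor Z (Σ X)),
    exact_triangle f g h <-> exact_triangle g h (- Σm f);
  tri_mor : forall (X Y Z X' Y' Z' : T)
      (f : mor X Y) (g : mor Y Z) (h : mor Z (Σ X))
      (f' : mor X' Y') (g' : mor Y' Z') (h' : mor Z' (Σ X'))
      (u : mor X X') (v : mor Y Y'),
    exact_triangle f g h -> exact_triangle f' g' h' -> v ∘ f = f' ∘ u ->
    exists w : mor Z Z', w ∘ g = g' ∘ v /\ h' ∘ w = Σm u ∘ h;
  tri_octahedral : forall (X Y Z U V W : T)
      (a1 : mor X Y) (a2 : mor Y U) (a3 : mor U (Σ X))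
      (b1 : mor Y Z) (b2 : mor Z W) (b3 : mor W (Σ Y))
      (c2 : mor Z V) (c3 : mor V (Σ X)),
    exact_triangle a1 a2 a3 -> exact_triangle b1 b2 b3 ->
    exact_triangle (b1 ∘ a1) c2 c3 ->
    exists (d1 : mor U V) (d2 : mor V W),
      [/\ exact_triangle d1 d2 (Σm a2 ∘ b3),
          d1 ∘ a2 = c2 ∘ b1, c3 ∘ d1 = a3,
          d2 ∘ c2 = b2 & b3 ∘ d2 = Σm a1 ∘ c3] }.

(* The suspension of the opposite category is the quasi-inverse of Sigma.  A
   triangle X -f-> Y -g-> Z -h-> Sigma^-1 X of the opposite category is exact
   when Z -g-> Y -f-> X -h'-> Sigma Z is exact, where h' is Sigma h up to the
   identification of Sigma (Sigma^-1 X) with X. *)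
Definition opTri (T : triData) : triData :=
  @TriData (opCat T) (opEndo (@unshift T)) (opEndo (@shift T))
    (@shift_unit T)
    (fun X => let: ex_intro g (conj gf fg) := shift_unit_iso X in
              ex_intro _ g (conj fg gf))
    (fun X Y f => shift_unit_nat f)
    (@shift_counit T)
    (fun X => let: ex_intro g (conj gf fg) := shift_counit_iso X in
              ex_intro _ g (conj fg gf))
    (fun X Y f => shift_counit_nat f)
    (fun X Y Z (f : @mor T Y X) (g : @mor T Z Y) (h : @mor T (unshift X) Z) =>
       exists h' : @mor T X (Σ Z),
         h' ∘ shift_counit X = Σm h /\ exact_triangle g f h').

Section DirectSum.
Variables (I : smallType) (M : I -> zmodType).

Record dsum := DSum {
  dval :> forall i, M i;
  dval_finite : finite_set [set i | dval i <> 0] }.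

HB.instance Definition _ := gen_eqMixin dsum.
HB.instance Definition _ := gen_choiceMixin dsum.

Lemma dsumP (x y : dsum) : (forall i, x i = y i) -> x = y.
Proof.
case: x y => [x hx] [y hy] /= xy.
have {}xy : x = y by apply: functional_extensionality_dep.
by subst y; congr DSum; apply: Prop_irrelevance.
Qed.

Lemma dsum_zero_subproof : finite_set [set i | (0 : M i) <> 0].
Proof. by apply: (sub_finite_set _ (finite_set0 I)) => i /=. Qed.

Lemma dsum_opp_subproof (x : dsum) : finite_set [set i | - x i <> 0].
Proof.
by apply: (sub_finite_set _ (dval_finite x)) => i /= + xi; rewrite xi oppr0.
Qed.

Lemma dsum_add_subproof (x y : dsum) : finite_set [set i | x i + y i <> 0].
Proof.
have fin : finite_set ([set i | x i <> 0] `|` [set i | y i <> 0]).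
  by rewrite finite_setU; split; apply: dval_finite.
apply: (sub_finite_set _ fin) => i /= xyi.
case: (pselect (x i = 0)) => xi; last by left.
by right; rewrite xi add0r in xyi.
Qed.

Definition dsum_zero : dsum := DSum dsum_zero_subproof.
Definition dsum_opp (x : dsum) : dsum := DSum (dsum_opp_subproof x).
Definition dsum_add (x y : dsum) : dsum := DSum (dsum_add_subproof x y).

Lemma dsum_addA : associative dsum_add.
Proof. by move=> x y z; apply: dsumP => i /=; rewrite addrA. Qed.
Lemma dsum_addC : commutative dsum_add.
Proof. by move=> x y; apply: dsumP => i /=; rewrite addrC. Qed.
Lemma dsum_add0 : left_id dsum_zero dsum_add.
Proof. by move=> x; apply: dsumP => i /=; rewrite add0r. Qed.
Lemma dsum_addN : left_inverse dsum_zero dsum_opp dsum_add.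
Proof. by move=> x; apply: dsumP => i /=; rewrite addNr. Qed.

HB.instance Definition _ :=
  GRing.isZmodule.Build dsum dsum_addA dsum_addC dsum_add0 dsum_addN.

End DirectSum.

Section DirectSumMap.
Variables (I : smallType) (M N : I -> zmodType).
Variable phi : forall i, {additive M i -> N i}.

Lemma dsum_map_subproof (x : dsum M) : finite_set [set i | phi i (x i) <> 0].
Proof.
by apply: (sub_finite_set _ (dval_finite x)) => i /= + xi; rewrite xi raddf0.
Qed.

Definition dsum_map (x : dsum M) : dsum N := DSum (dsum_map_subproof x).

Lemma dsum_map_zmod_morphism : zmod_morphism dsum_map.
Proof. by move=> x y; apply: dsumP => i; apply: raddfB. Qed.

HB.instance Definition _ :=
  GRing.isZmodMorphism.Build (dsum M) (dsum N) dsum_map dsum_map_zmod_morphism.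

End DirectSumMap.

Record abFunctor (C : preaddCat) := AbFunctor {
  aobj :> C -> zmodType;
  amap : forall X Y, mor X Y -> {additive aobj X -> aobj Y};
  amap1 : forall X x, amap (idm X) x = x;
  amapM : forall X Y Z (g : mor Y Z) (f : mor X Y) x,
    amap (g ∘ f) x = amap g (amap f x);
  amapD : forall X Y (f g : mor X Y) x, amap (f + g) x = amap f x + amap g x }.

Arguments amap {C} a {X Y} f.

Definition natural_iso (C : preaddCat) (F G : abFunctor C) : Prop :=
  exists eta : forall X, {additive F X -> G X},
    (forall X, bijective (eta X)) /\
    (forall (X Y : C) (f : mor X Y) x,
      eta Y (amap F f x) = amap G f (eta X x)).

Section HomFunctor.
Variables (C : preaddCat) (X : C).

Definition postcomp (Y Z : C) (g : mor Y Z) (f : mor X Y) : mor X Z := g ∘ f.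

Lemma postcomp_zmod_morphism Y Z (g : mor Y Z) : zmod_morphism (postcomp g).
Proof.
move=> f f'; rewrite /postcomp; apply: (addIr (g ∘ f')).
by rewrite -mcompDr !subrK.
Qed.

HB.instance Definition _ Y Z (g : mor Y Z) :=
  GRing.isZmodMorphism.Build (mor X Y) (mor X Z) (postcomp g)
    (postcomp_zmod_morphism g).

Definition homFunctor : abFunctor C :=
  @AbFunctor C (fun Y => mor X Y) (fun Y Z g => postcomp g)
    (fun Y f => mcomp1m f) (fun Y Z W g f x => esym (mcompA g f x))
    (fun Y Z g g' f => mcompDl g g' f).

End HomFunctor.

Section DirectSumFunctor.
Variables (C : preaddCat) (I : smallType) (F : I -> abFunctor C).

Definition dsumFunctor : abFunctor C.
Proof.
refine (@AbFunctor C (fun X => dsum (fun i => F i X))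
  (fun X Y f => dsum_map (fun i => amap (F i) f)) _ _ _).
- by move=> X x; apply: dsumP => i; apply: amap1.
- by move=> X Y Z g f x; apply: dsumP => i; apply: amapM.
- by move=> X Y f g x; apply: dsumP => i; apply: amapD.
Defined.

End DirectSumFunctor.

Definition cohomological (T : triData) (H : abFunctor T) : Prop :=
  forall (X Y Z : T) (f : mor X Y) (g : mor Y Z) (h : mor Z (Σ X)),
    exact_triangle f g h ->
    forall y : H Y, amap H g y = 0 <-> exists x : H X, amap H f x = y.

(* The functor T^op -> Ab represented by X. *)
Definition representable (T : triData) (X : T) : abFunctor (opTri T) :=
  homFunctor (X : opTri T).

Definition locally_noetherian (T : triData) : Prop :=
  forall H : abFunctor (opTri T), cohomological H ->
    exists (I : smallType) (X : I -> T),
      natural_iso H (dsumFunctor (fun i => representable (X i))).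

Definition locally_finite (T : triData) : Prop :=
  locally_noetherian T /\ locally_noetherian (opTri T).

(* A full subcategory is given by its class of objects.  [set T] and [finite_set]
   are avoided here: they would force the objects of T into the universe of the
   carriers of [zmodType]. *)
Definition subcategory (T : triData) := T -> Prop.

Record triangulated_subcategory (T : triData) (S : subcategory T) : Prop := {
  tsub_nonempty : exists X, S X;
  tsub_shift : forall X, S X -> S (shift X);
  tsub_unshift : forall X, S X -> S (unshift X);
  tsub_two_of_three :
    forall (X Y Z : T) (f : mor X Y) (g : mor Y Z) (h : mor Z (Σ X)),
    exact_triangle f g h ->
    [/\ S X -> S Y -> S Z, S Y -> S Z -> S X & S X -> S Z -> S Y] }.

Definition thick (T : triData) (S : subcategory T) : Prop :=
  triangulated_subcategory S /\
  (forall X Y : T, direct_summand X Y -> S Y -> S X).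

Definition Thick (T : triData) (X : T) : subcategory T :=
  fun Y => forall S : subcategory T, thick S -> S X -> S Y.

Definition finitely_generated (T : triData) : Prop :=
  exists X : T, forall Y : T, Thick X Y.

Definition finitely_many_thick (T : triData) : Prop :=
  exists (n : nat) (S : 'I_n -> subcategory T),
    forall S' : subcategory T, thick S' <-> exists i, S' = S i.

(* Main.v *)
Require Import Defs.
From mathcomp Require Import all_boot.
From HB Require Import structures.
From mathcomp Require Import all_algebra.
From mathcomp Require Import boolp classical_sets cardinality.

(* Local noetherianity is used only through a form of Bass' condition: for every
   sequence X_0 -> X_1 -> ..., the functor colim Hom(-, X_n) is cohomological,
   hence a sum of representables, so some composite X_0 -> X_n factors through an
   object Y -> X_n that is still a retract after X_n -> X_(n+1).  It follows that
   idempotents split, that every object is a finite sum of indecomposables, whose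
   endomorphism rings are local, and, taking cones, that every functor of maps into
   X closed under addition is finitely generated.  Right almost split maps therefore
   exist, and with the condition for the opposite category one gets that only
   finitely many indecomposables map nontrivially to a given object.  As the
   hypotheses are self-dual, only finitely many indecomposables L_i receive a
   nonzero map from the generator X.

   Let S be thick and G the thick subcategory generated by the L_i in S.  For A in S
   there is a triangle Y -> A -> B -> with Y in G and Hom(G, B) = 0 (Wakamatsu's
   lemma for a minimal approximation).  A nonzero map from X to an object of S
   orthogonal to G would hit an indecomposable summand isomorphic to some L_i in S,
   which lies in G; so Hom(X, -) vanishes on all shifts of B, whence B = 0 and A is
   in G.  Thus S is determined by the set of the L_i that it contains. *)

Set Implicit Arguments.
Unset Strict Implicit.
Unset Printing Implicit Defensive.

Import GRing.Theory.
Local Open Scope ring_scope.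

(** * Dependent choice and minimal elements *)

Lemma dependent_choice (A : Type) (P : A -> Prop) (R : A -> A -> Prop) a :
  P a -> (forall x, P x -> exists y, P y /\ R x y) ->
  exists s : nat -> A, [/\ s 0 = a, forall n, P (s n) & forall n, R (s n) (s n.+1)].
Proof.
move=> Pa nextP.
have step (x : {x | P x}) : {y : {x | P x} | R (sval x) (sval y)}.
  by apply: cid; case: x => x Px /=; have [y [Py Rxy]] := nextP x Px; exists (exist _ y Py).
pose s := fix s n := if n is k.+1 then sval (step (s k)) else exist _ a Pa.
exists (fun n => sval (s n)); split=> // n; first exact: svalP.
exact: (svalP (step (s n))).
Qed.

Lemma minimal_element (A : Type) (P : A -> Prop) (R : A -> A -> Prop) a :
  (forall s : nat -> A, exists n, ~ R (s n) (s n.+1)) ->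
  P a -> exists2 x, P x & forall y, P y -> ~ R x y.
Proof.
move=> noseq Pa; apply: contrapT => nomin.
have [|s [_ _ Rs]] := dependent_choice (R := R) Pa.
  move=> x Px; apply: contrapT => nonext; apply: nomin; exists x => // y Py Rxy.
  by apply: nonext; exists y.
by have [n] := noseq s.
Qed.

(** * Composition in preadditive categories *)

Section Preadditive.
Variable C : preaddCat.
Implicit Types X Y Z W : C.

Lemma comp0m X Y Z (f : mor X Y) : (0 : mor Y Z) ∘ f = 0.
Proof. by apply: (addIr (0 ∘ f)); rewrite -mcompDl !add0r. Qed.

Lemma compm0 X Y Z (g : mor Y Z) : g ∘ (0 : mor X Y) = 0.
Proof. by apply: (addIr (g ∘ 0)); rewrite -mcompDr !add0r. Qed.

Lemma compNm X Y Z (g : mor Y Z) (f : mor X Y) : (- g) ∘ f = - (g ∘ f).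
Proof. by apply: (addIr (g ∘ f)); rewrite -mcompDl !addNr comp0m. Qed.

Lemma compmN X Y Z (g : mor Y Z) (f : mor X Y) : g ∘ (- f) = - (g ∘ f).
Proof. by apply: (addIr (g ∘ f)); rewrite -mcompDr !addNr compm0. Qed.

Lemma comp_suml X Y Z (I : finType) (g : I -> mor Y Z) (f : mor X Y) :
  (\sum_i g i) ∘ f = \sum_i (g i ∘ f).
Proof.
apply: (big_morph (fun g : mor Y Z => g ∘ f)) => [g1 g2|]; first exact: mcompDl.
exact: comp0m.
Qed.

Lemma comp_sumr X Y Z (I : finType) (g : mor Y Z) (f : I -> mor X Y) :
  g ∘ (\sum_i f i) = \sum_i (g ∘ f i).
Proof.
apply: (big_morph (fun f : mor X Y => g ∘ f)) => [f1 f2|]; first exact: mcompDr.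
exact: compm0.
Qed.

Lemma is_iso_id X : is_iso (idm X).
Proof. by exists (idm X); rewrite mcomp1m. Qed.

Lemma is_iso_splitmono X Y (f : mor X Y) (r : mor Y X) :
  is_iso f -> r ∘ f = idm X -> f ∘ r = idm Y.
Proof.
move=> [g [gf fg]] rf.
by rewrite -(mcompm1 r) -fg (mcompA r) rf mcomp1m.
Qed.

Lemma isomorphic_sym X Y : isomorphic X Y -> isomorphic Y X.
Proof. by move=> [f [g [gf fg]]]; exists g, f. Qed.

(** * Bass' condition: idempotents, decompositions and generators *)

Fixpoint comp_seq (X : nat -> C) (f : forall n, mor (X n) (X n.+1)) n :
    mor (X 0) (X n) :=
  if n is k.+1 then f k ∘ comp_seq f k else idm (X 0).

Definition bass : Prop :=
  forall (X : nat -> C) (f : forall n, mor (X n) (X n.+1)),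
  exists n Y (a : mor (X 0) Y) (s : mor Y (X n)) (p : mor (X n.+1) Y),
    comp_seq f n = s ∘ a /\ p ∘ f n ∘ s = idm Y.

(** The middle clause makes [g] in turn a weak kernel of [c], as for consecutive maps of an exact
    triangle. *)
Definition weak_cokernels : Prop :=
  forall P X (g : mor P X), exists D (c : mor X D),
    [/\ c ∘ g = 0,
        forall W (y : mor W X), c ∘ y = 0 -> exists x, y = g ∘ x
      & forall W (y : mor X W), y ∘ g = 0 -> exists x, y = x ∘ c].

Definition indecomposable Z : Prop :=
  idm Z <> 0 /\ forall e : mor Z Z, e ∘ e = e -> e = 0 \/ e = idm Z.

Definition proper_retract X Y : Prop :=
  exists (s : mor Y X) (r : mor X Y), r ∘ s = idm Y /\ ~ is_iso s.

Lemma comp_seq_retr (X : nat -> C) (f : forall n, mor (X n) (X n.+1)) n :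
  (forall n, exists s, f n ∘ s = idm (X n.+1)) ->
  exists s, comp_seq f n ∘ s = idm (X n).
Proof.
move=> fs; elim: n => [|n [s IH]] /=; first by exists (idm _); rewrite mcompm1.
have [t ft] := fs n; exists (s ∘ t).
by rewrite mcompA -(mcompA (f n)) IH mcompm1.
Qed.

(** In a chain of retractions [r n] the composite to [X n] is split epi, so the split mono [t] from
    Bass' condition is invertible, with inverse [p ∘ r n]. Thus [r n] is also split mono, and its
    section [s n] is an isomorphism. *)
Lemma proper_retract_wf (X : nat -> C) :
  bass -> exists n, ~ proper_retract (X n) (X n.+1).
Proof.
move=> bassC; apply: contrapT => noend.
have sr n : {s : mor (X n.+1) (X n) & {r | r ∘ s = idm _ /\ ~ is_iso s}}.
  have /cid[s /cid[r rsP]] : proper_retract (X n) (X n.+1).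
    by apply: contrapT => h; apply: noend; exists n.
  by exists s, r.
pose s n := projT1 (sr n); pose r n := sval (projT2 (sr n)).
have rs n : r n ∘ s n = idm _ := proj1 (svalP (projT2 (sr n))).
have sN n : ~ is_iso (s n) := proj2 (svalP (projT2 (sr n))).
have [n [Y [a [t [p [rE pt]]]]]] := bassC X r.
have [u] := comp_seq_retr n (fun k => ex_intro _ _ (rs k)).
rewrite rE -mcompA => tau; apply: (sN n); exists (r n); split=> //.
have tpr : t ∘ (p ∘ r n) = idm _.
  rewrite -tau; congr (t ∘ _).
  by rewrite -(mcompm1 (p ∘ r n)) -tau mcompA pt mcomp1m.
by rewrite -(mcomp1m (s n)) -tpr -!mcompA (mcompA (r n)) rs mcomp1m.
Qed.

Lemma splits_idempotent (X : C) (e : mor X X) : bass -> e ∘ e = e ->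
  exists Z (s : mor Z X) (r : mor X Z), r ∘ s = idm Z /\ s ∘ r = e.
Proof.
move=> bassC ee; have [n [Z [a [s [p [eE pes]]]]]] := bassC (fun=> X) (fun=> e).
(* The extra factor [e] covers [n = 0], where the composite is [idm X] instead of [e]. *)
have {}eE : e ∘ s ∘ a = e.
  by rewrite -mcompA -eE; elim: {a s p eE pes} n => [|n IH] /=; rewrite ?mcompm1 // mcompA ee.
have rs : p ∘ e ∘ (e ∘ s) = idm Z by rewrite mcompA -(mcompA p e e) ee.
exists Z, (e ∘ s), (p ∘ e); split=> //.
have <- : e ∘ s ∘ (p ∘ e) ∘ e = e ∘ s ∘ (p ∘ e) by rewrite -!mcompA ee.
by rewrite -[X in _ ∘ X = _]eE -(mcompA (e ∘ s)) (mcompA (p ∘ e)) rs mcomp1m.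
Qed.

(* The summands need not form a direct sum: retracts suffice. *)
Definition decomposes (X : C) : Prop :=
  exists (I : finType) (Z : I -> C) (s : forall i, mor (Z i) X) (r : forall i, mor X (Z i)),
    [/\ forall i, indecomposable (Z i), forall i, r i ∘ s i = idm (Z i)
       & \sum_i s i ∘ r i = idm X].

(** Among the objects without decomposition take one with no proper retract of the same kind. A
    nontrivial idempotent splits it into two proper retracts, whose decompositions combine. *)
Lemma all_decompose (X : C) : bass -> decomposes X.
Proof.
move=> bassC; apply: contrapT => nX.
have [Y nY minY] := minimal_element (P := fun X => ~ decomposes X)
  (fun s => proper_retract_wf s bassC) nX.
apply: nY; case: (pselect (idm Y = 0)) => [Y0|Yn0].
  exists void, (fun i => Y), (fun i => idm Y), (fun i => idm Y).
  by split=> [[]|[]|]; rewrite Y0 big1 // => -[].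
case: (pselect (indecomposable Y)) => [indY|].
  exists unit, (fun i => Y), (fun i => idm Y), (fun i => idm Y); split=> // [_|].
    by rewrite mcomp1m.
  by rewrite (big_pred1 tt) ?mcomp1m // => -[].
move=> nind; have [e [ee e0 e1]] : exists e : mor Y Y, [/\ e ∘ e = e, e <> 0 & e <> idm Y].
  apply: contrapT => he; apply: nind; split=> // e ee.
  case: (pselect (e = 0)) => [|e0]; first by left.
  by right; apply: contrapT => e1; apply: he; exists e.
have part (e' : mor Y Y) : e' ∘ e' = e' -> e' <> idm Y ->
    exists Z, decomposes Z /\ exists (s : mor Z Y) (r : mor Y Z), r ∘ s = idm Z /\ s ∘ r = e'.
  move=> ee' e1'; have [Z [s [r [rs sr]]]] := splits_idempotent bassC ee'.
  exists Z; split; last by exists s, r.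
  apply: contrapT => /minY; apply; exists s, r; split=> // s_iso.
  by apply: e1'; rewrite -sr; apply: is_iso_splitmono.
have [Z [[I [V [s [r [indV rs sr]]]]] [t [q [qt tq]]]]] := part e ee e1.
have [||Z' [[I' [V' [s' [r' [indV' rs' sr']]]]] [t' [q' [qt' tq']]]]] := part (idm Y - e).
- by rewrite mcompDl mcomp1m compNm mcompDr mcompm1 compmN ee subrr subr0.
- by move=> e1'; apply: e0; apply: oppr_inj; apply: (addrI (idm Y)); rewrite e1' oppr0 addr0.
pose U (k : I + I') := match k with inl i => V i | inr j => V' j end.
pose sU k : mor (U k) Y := match k with inl i => t ∘ s i | inr j => t' ∘ s' j end.
pose rU k : mor Y (U k) := match k with inl i => r i ∘ q | inr j => r' j ∘ q' end.
exists (I + I')%type, U, sU, rU; split=> [[]|[i|i]|] //=.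
- by rewrite mcompA -(mcompA (r i)) qt mcompm1.
- by rewrite mcompA -(mcompA (r' i)) qt' mcompm1.
rewrite big_sumType /=.
under eq_bigr => i _ do rewrite -mcompA (mcompA _ _ q).
under [X in _ + X]eq_bigr => i _ do rewrite -mcompA (mcompA _ _ q').
by rewrite -!comp_sumr -!comp_suml sr sr' !mcomp1m tq tq' addrC subrK.
Qed.

(** [F] picks generators of a subfunctor of Hom(-, [X]): closure under biproducts makes the maps
    factoring through members of [F] stable under addition. *)
Definition noetherian : Prop :=
  forall X (F : forall Y, mor Y X -> Prop),
  (exists Y (g : mor Y X), F Y g) ->
  (forall Y1 Y2 P (i : mor Y1 P) (j : mor Y2 P) (p : mor P Y1) (q : mor P Y2)
      (g1 : mor Y1 X) (g2 : mor Y2 X),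
    is_biproduct i j p q -> F Y1 g1 -> F Y2 g2 -> F P (g1 ∘ p + g2 ∘ q)) ->
  exists Y (g : mor Y X), F Y g /\
    forall Y' (g' : mor Y' X), F Y' g' -> exists x, g' = g ∘ x.

(* An ascending chain of images of maps [P n -> X] gives a sequence of cokernels
   [D 0 -> D 1 -> ...] under X, and Bass' condition for it bounds the kernels of
   the maps [X -> D n]. *)
Lemma bass_noetherian :
  bass -> additive_category C -> weak_cokernels -> noetherian.
Proof.
move=> bassC [_ biprod] wcok X F [Y0 [g0 Fg0]] Fadd; apply: contrapT => ngen.
pose A := {Y & mor Y X}.
have [|s [_ _ sR]] := dependent_choice (a := existT _ Y0 g0 : A)
   (P := fun a => F (projT1 a) (projT2 a))
   (R := fun a b => (exists x, projT2 a = projT2 b ∘ x) /\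
      exists W (y : mor W X), (exists x, y = projT2 b ∘ x) /\
        ~ exists x, y = projT2 a ∘ x) Fg0.
  move=> [Y g] /= Fg; have [Y' [g' [Fg' ngg']]] : exists Y' (g' : mor Y' X),
      F Y' g' /\ ~ exists x, g' = g ∘ x.
    apply: contrapT => h; apply: ngen; exists Y, g; split=> // Y' g' Fg'.
    by apply: contrapT => h'; apply: h; exists Y', g'.
  have [P [i [j [p [q bip]]]]] := biprod Y Y'.
  have [pi qj qi pj _] := bip.
  exists (existT _ P (g ∘ p + g' ∘ q)) => /=; split; first exact: Fadd bip Fg Fg'.
  split; first by exists i; rewrite mcompDl -!mcompA pi qi mcompm1 compm0 addr0.
  exists Y', g'; split=> //; exists j.
  by rewrite mcompDl -!mcompA pj qj mcompm1 compm0 add0r.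
pose P n := projT1 (s n); pose g n : mor (P n) X := projT2 (s n).
have /(_ _)/cid coneg n : exists D, exists c : mor X D,
    [/\ c ∘ g n = 0,
        forall W (y : mor W X), c ∘ y = 0 -> exists x, y = g n ∘ x
      & forall W (y : mor X W), y ∘ g n = 0 -> exists x, y = x ∘ c] := wcok _ _ (g n).
pose D n := projT1 (coneg n).
have /(_ _)/cid cP n := svalP (coneg n).
pose c n : mor X (D n) := sval (cP n).
have cg n : c n ∘ g n = 0 by case: (svalP (cP n)).
have cker n W (y : mor W X) : c n ∘ y = 0 -> exists x, y = g n ∘ x.
  by case: (svalP (cP n)) => _ + _; apply.
have /(_ _)/cid f n : exists f, c n.+1 = f ∘ c n.
  case: (svalP (cP n)) => _ _; apply; have [[x gx] _] := sR n.
  by rewrite (gx : g n = g n.+1 ∘ x) mcompA cg comp0m.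
have [n [Y [a [t [p [ct pt]]]]]] := bassC D (fun n => sval (f n)).
have cE m : c m = comp_seq (fun n => sval (f n)) m ∘ c 0.
  elim: m => [|m IH] /=; first by rewrite mcomp1m.
  by rewrite -mcompA -IH -(svalP (f m)).
have [_ [W [y [[x yE] ny]]]] := sR n; apply: ny; apply: cker.
have cy : c n.+1 ∘ y = 0 by rewrite yE mcompA cg comp0m.
(* Applying [p] to [c n.+1 ∘ y = 0] leaves [a ∘ c 0 ∘ y = 0], since [p] cancels [f n ∘ t]; hence
   [c n ∘ y = 0]. *)
have ay : a ∘ c 0 ∘ y = 0.
  rewrite -(mcomp1m (a ∘ c 0 ∘ y)) -pt -!mcompA (mcompA t a) -ct.
  by rewrite (mcompA _ (c 0)) -cE (mcompA _ (c n)) -(svalP (f n)) cy compm0.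
by rewrite cE ct -!mcompA (mcompA a (c 0)) ay compm0.
Qed.

(** A form of Fitting's lemma: the endomorphism ring is local. In Bass' condition for the powers of
    [a], the idempotent [a ∘ s ∘ p] is the identity, so that [a] is split epi, or zero. If it is
    zero, then [Y] is zero, a power of [a] vanishes, and a geometric series gives a right inverse of
    [b = idm Z - a]. *)
Lemma sum1_splitepi Z (a b : mor Z Z) : bass -> indecomposable Z ->
  a + b = idm Z ->
  (exists s, a ∘ s = idm Z) \/ (exists s, b ∘ s = idm Z).
Proof.
move=> bassC [Z0 indZ] ab; have [n [Y [u [s [p [aE pas]]]]]] := bassC (fun=> Z) (fun=> a).
have bE : b = idm Z - a by rewrite -ab addrC addKr.
have nilp : comp_seq (X := fun=> Z) (fun=> a) n = 0 -> exists t, b ∘ t = idm Z.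
  have [t tE] : exists t, b ∘ t = idm Z - comp_seq (X := fun=> Z) (fun=> a) n.
    elim: {s p u aE pas} n => [|n [t IH]] /=; first by exists 0; rewrite subrr compm0.
    set an := comp_seq _ _ in IH *; exists (t + an).
    by rewrite mcompDr IH bE mcompDl compNm mcomp1m addrA subrK.
  by move=> an0; exists t; rewrite tE an0 subr0.
have Y0 : idm Y = 0 -> exists t, b ∘ t = idm Z.
  by move=> Y0; apply: nilp; rewrite aE -(mcomp1m u) Y0 comp0m compm0.
have aspasp : (a ∘ s ∘ p) ∘ (a ∘ s ∘ p) = a ∘ s ∘ p.
  by rewrite -(mcompA (a ∘ s)) (mcompA p) (mcompA p) pas mcomp1m.
have [asp|asp] := indZ _ aspasp; last by left; exists (s ∘ p); rewrite mcompA.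
right; apply: Y0; rewrite -(mcomp1m (idm Y)) -pas -!mcompA.
by rewrite (mcompA s) (mcompA a) (mcompA a s) asp comp0m compm0.
Qed.

(** * Right almost split maps *)

Definition splitepi Y Z (g : mor Y Z) : Prop := exists s, g ∘ s = idm Z.

(** By locality of the endomorphism ring, the maps to [Z] that are not split epi are closed under
    sums, so [noetherian] applies to them. *)
Lemma almost_split Z :
  bass -> noetherian -> (exists O : C, is_zero O) -> indecomposable Z ->
  exists E (g : mor E Z), ~ splitepi g /\
    forall Y (h : mor Y Z), ~ splitepi h -> exists x, h = g ∘ x.
Proof.
move=> bassC noethC [O O0] indZ; apply: (noethC Z (fun Y g => ~ splitepi g)).
  exists O, 0 => -[s]; rewrite comp0m => /esym; exact: (proj1 indZ).
move=> Y1 Y2 P i j p q g1 g2 _ ng1 ng2 [s]; rewrite mcompDl -!mcompA => gs.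
have [[t gt]|[t gt]] := sum1_splitepi bassC indZ gs.
- by apply: ng1; exists (p ∘ s ∘ t); rewrite mcompA.
- by apply: ng2; exists (q ∘ s ∘ t); rewrite mcompA.
Qed.

(** * Indecomposables with a nonzero map to a given object *)

Definition finite_upto_iso (P : C -> Prop) : Prop :=
  exists (I : finType) (L : I -> C), forall Y, P Y -> exists i, isomorphic Y (L i).

Lemma finite_upto_iso_bigU (I : finType) (P : I -> C -> Prop) :
  (forall i, finite_upto_iso (P i)) -> finite_upto_iso (fun Y => exists i, P i Y).
Proof.
move=> /(_ _)/cid J; pose K i := sval (J i).
have /(_ _)/cid L i : exists L : K i -> C, forall Y, P i Y -> exists k, isomorphic Y (L k).
  exact: svalP (J i).
exists {i : I & K i}, (fun k => sval (L (projT1 k)) (projT2 k)) => Y [i PY].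
by have [k Yk] := svalP (L i) Y PY; exists (existT _ i k).
Qed.

Definition nonzero_along X Z (u : mor Z X) (Y : C) : Prop :=
  indecomposable Y /\ exists g : mor Y Z, u ∘ g <> 0.

(** If [u ∘ g] is nonzero, so is [u ∘ s i ∘ r i ∘ g] for one of the finitely many indecomposable
    summands of [Z]. *)
Lemma infinite_summand X Z (u : mor Z X) : bass ->
  ~ finite_upto_iso (nonzero_along u) ->
  exists Z' (s : mor Z' Z) (r : mor Z Z'), [/\ indecomposable Z', r ∘ s = idm Z'
    & ~ finite_upto_iso (nonzero_along (u ∘ s))].
Proof.
move=> bassC inf; have [I [V [s [r [indV rs sr]]]]] := all_decompose Z bassC.
apply: contrapT => h; apply: inf.
have [|J [L LP]] := @finite_upto_iso_bigU I (fun i => nonzero_along (u ∘ s i)).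
  by move=> i; apply: contrapT => inf; apply: h; exists (V i), (s i), (r i).
exists J, L => Y [indY [g ug]]; apply: LP; apply: contrapT => ng; apply: ug.
rewrite -(mcomp1m g) -sr comp_suml comp_sumr big1 // => i _.
apply: contrapT => usrg; apply: ng; exists i; split=> //; exists (r i ∘ g).
by rewrite -!mcompA in usrg *.
Qed.

(** The inductive step of Koenig's lemma. A map from an indecomposable [Y] to [Z] is an isomorphism
    or factors through the right almost split map [g], so infinitely many classes survive along
    [u ∘ g], and hence along one summand of its source. *)
Lemma infinite_radical X Z (u : mor Z X) :
  bass -> noetherian -> (exists O : C, is_zero O) -> indecomposable Z ->
  ~ finite_upto_iso (nonzero_along u) ->
  exists Z' (e : mor Z' Z), [/\ indecomposable Z', ~ splitepi e
    & ~ finite_upto_iso (nonzero_along (u ∘ e))].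
Proof.
move=> bassC noethC zeroC indZ inf; have [E [g [ng gP]]] := almost_split bassC noethC zeroC indZ.
have [[J [L LP]]|] := pselect (finite_upto_iso (nonzero_along (u ∘ g))).
  case: inf; exists (option J), (fun k => if k is Some j then L j else Z) => Y [indY [h uh]].
  case: (pselect (splitepi h)) => [[t ht]|/gP[x hx]].
    exists None; exists h, t; split=> //.
    have thth : (t ∘ h) ∘ (t ∘ h) = t ∘ h by rewrite -mcompA (mcompA h) ht mcomp1m.
    case: (proj2 indY _ thth) => // th; case: (proj1 indZ).
    by rewrite -(mcomp1m (idm Z)) -ht -mcompA (mcompA t) th comp0m compm0.
  have [|j Yj] := LP Y; last by exists (Some j).
  by split=> //; exists x; rewrite -mcompA -hx.
move=> /(infinite_summand bassC) [Z' [s [r [indZ' _ inf']]]].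
exists Z', (g ∘ s); split=> //; last by rewrite mcompA.
by move=> [t gst]; apply: ng; exists (s ∘ t); rewrite mcompA.
Qed.

End Preadditive.

(* An infinite set of such Y would, by Koenig's lemma along right almost split
   maps, give a sequence of radical maps between indecomposables with nonzero
   composites, against Bass' condition in the opposite category. *)
Lemma finite_indecomposables (C : preaddCat) (X : C) :
  bass C -> bass (opCat C) -> noetherian C -> (exists O : C, is_zero O) ->
  finite_upto_iso (fun Y => indecomposable Y /\ exists g : mor Y X, g <> 0).
Proof.
move=> bassC bass_op noethC zeroC; apply: contrapT => inf.
have [|Z0 [s0 [_ [indZ0 _ inf0]]]] := @infinite_summand C X X (idm X) bassC.
  move=> [I [L LP]]; apply: inf; exists I, L => Y [indY [g g0]]; apply: LP; split=> //.
  by exists g; rewrite mcomp1m.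
pose A := {Z : C & mor Z X}.
have [|z [_ zP zR]] := dependent_choice (a := existT _ Z0 (idm X ∘ s0) : A)
   (P := fun a => indecomposable (projT1 a) /\ ~ finite_upto_iso (nonzero_along (projT2 a)))
   (R := fun a b => exists e : mor (projT1 b) (projT1 a),
       ~ splitepi e /\ projT2 b = projT2 a ∘ e) (conj indZ0 inf0).
  move=> [Z u] /= [indZ infu].
  have [Z' [e [indZ' ne infue]]] := infinite_radical bassC noethC zeroC indZ infu.
  by exists (existT _ Z' (u ∘ e)); split=> //=; exists e.
pose Z n := projT1 (z n); pose u n : mor (Z n) X := projT2 (z n).
have /(_ _)/cid e n : exists e : mor (Z n.+1) (Z n),
    ~ splitepi e /\ u n.+1 = u n ∘ e := zR n.
pose f n : @mor (opCat C) (Z n) (Z n.+1) := sval (e n).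
have [n [Y [a [s [p [fE pfs]]]]]] := bass_op Z f.
have uE m : u m = u 0 ∘ (comp_seq f m : mor (Z m) (Z 0)).
  elim: m => [|m IH] /=; first by rewrite mcompm1.
  rewrite (proj2 (svalP (e m))).
  exact: etrans (congr1 (fun v => v ∘ sval (e m)) IH) (esym (mcompA _ _ _)).
have u0 : u n <> 0.
  move=> u0; apply: (proj2 (zP n)); exists void, (fun=> X) => W [_ [g]].
  by case; rewrite (_ : projT2 (z n) = 0) ?comp0m.
move: Y a s p fE pfs.
change (forall (Y : C) (a : @mor C Y (Z 0)) (s : @mor C (Z n) Y) (p : @mor C Y (Z n.+1)),
  comp_seq f n = a ∘ s -> s ∘ (sval (e n) ∘ p) = idm Y -> False) => Y a s p fE.
rewrite mcompA => pfs.
have [indZ _] := zP n; set w := sval (e n) in pfs.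
(* If this idempotent of [Z n] is the identity, [e n] is split epi; if it is zero, then [s = 0] and
   [u n = 0]. Both are excluded. *)
have idem : (w ∘ p ∘ s) ∘ (w ∘ p ∘ s) = w ∘ p ∘ s.
  by rewrite -(mcompA (w ∘ p)) (mcompA s (w ∘ p)) (mcompA s w) pfs mcomp1m.
have [wps|wps] := proj2 indZ _ idem; last first.
  by apply: (proj1 (svalP (e n))); exists (p ∘ s); rewrite mcompA.
have s_0 : s = 0 by rewrite -(mcomp1m s) -pfs -!mcompA (mcompA w) wps compm0.
by apply: u0; rewrite uE fE s_0 !compm0.
Qed.

(** * Germs and colimits of sequences of representable functors *)

Definition eventually (P : nat -> Prop) : Prop := exists N, forall n, (N <= n)%N -> P n.

Lemma eventually_imp (P Q : nat -> Prop) :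
  (forall n, P n -> Q n) -> eventually P -> eventually Q.
Proof. by move=> PQ [N NP]; exists N => n /NP /PQ. Qed.

Lemma eventuallyI (P Q : nat -> Prop) :
  eventually P -> eventually Q -> eventually (fun n => P n /\ Q n).
Proof.
move=> [N NP] [M MQ]; exists (maxn N M) => n; rewrite geq_max => /andP[Nn Mn].
by split; [apply: NP|apply: MQ].
Qed.

Lemma eventually_forall (P : nat -> Prop) : (forall n, P n) -> eventually P.
Proof. by move=> PT; exists 0. Qed.

(* The colimit of the functors Hom(-, X n): a germ is a class of eventually
   compatible families of maps [W -> X n], two families being equivalent when
   they eventually agree. *)
Section SequentialColimit.
Variables (C : preaddCat) (X : nat -> C) (f : forall n, mor (X n) (X n.+1)).

Section Germ.
Variable W : C.
Implicit Types x y : forall n, mor W (X n).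

Definition eventually_compatible x : Prop :=
  eventually (fun n => x n.+1 = f n ∘ x n).

Definition eveq x y : Prop := eventually (fun n => x n = y n).

Lemma eveq_sym x y : eveq x y -> eveq y x.
Proof. exact: eventually_imp. Qed.

Lemma eveq_trans x y z : eveq x y -> eveq y z -> eveq x z.
Proof. by move=> xy yz; apply: eventually_imp (eventuallyI xy yz) => n [->]. Qed.

Definition germ : Type :=
  {P : (forall n, mor W (X n)) -> Prop | exists x, eventually_compatible x /\ P = eveq x}.

HB.instance Definition _ := gen_eqMixin germ.
HB.instance Definition _ := gen_choiceMixin germ.

Definition germ_of x (cx : eventually_compatible x) : germ :=
  exist _ (eveq x) (ex_intro _ x (conj cx erefl)).

Definition germ_repr (a : germ) : forall n, mor W (X n) := sval (cid (svalP a)).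

Lemma germ_repr_compatible a : eventually_compatible (germ_repr a).
Proof. exact: (proj1 (svalP (cid (svalP a)))). Qed.

Lemma germ_of_repr x cx : eveq (germ_repr (@germ_of x cx)) x.
Proof.
have := proj2 (svalP (cid (svalP (germ_of cx)))); rewrite -/(germ_repr _) /= => e.
by rewrite -e; apply: eventually_forall.
Qed.

Lemma germ_eq a b : eveq (germ_repr a) (germ_repr b) -> a = b.
Proof.
move=> ab; have aE := proj2 (svalP (cid (svalP a))).
have bE := proj2 (svalP (cid (svalP b))); rewrite -!/(germ_repr _) in aE bE.
apply: eq_sig_hprop => [P ? ?|]; first exact: Prop_irrelevance.
rewrite aE bE; apply: funext => x; apply: propext.
by split; apply: eveq_trans => //; apply: eveq_sym.
Qed.

Lemma compatible0 : eventually_compatible (fun n => 0).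
Proof. by apply: eventually_forall => n; rewrite compm0. Qed.

Lemma compatibleN a : eventually_compatible (fun n => - germ_repr a n).
Proof. by apply: eventually_imp (germ_repr_compatible a) => n ->; rewrite compmN. Qed.

Lemma compatibleD a b :
  eventually_compatible (fun n => germ_repr a n + germ_repr b n).
Proof.
apply: eventually_imp (eventuallyI (germ_repr_compatible a) (germ_repr_compatible b)).
by move=> n [-> ->]; rewrite mcompDr.
Qed.

Definition germ_add a b : germ := germ_of (compatibleD a b).
Definition germ_opp a : germ := germ_of (compatibleN a).
Definition germ_zero : germ := germ_of compatible0.

Lemma germ_addE a b :
  eveq (germ_repr (germ_add a b)) (fun n => germ_repr a n + germ_repr b n).
Proof. exact: germ_of_repr. Qed.

Lemma germ_addA : associative germ_add.
Proof.
move=> a b c; apply: germ_eq.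
apply: eventually_imp (eventuallyI (eventuallyI (germ_addE a (germ_add b c))
  (germ_addE (germ_add a b) c)) (eventuallyI (germ_addE a b) (germ_addE b c))).
by move=> n [[-> ->] [-> ->]]; rewrite addrA.
Qed.

Lemma germ_addC : commutative germ_add.
Proof.
move=> a b; apply: germ_eq; apply: eventually_imp (eventuallyI (germ_addE a b) (germ_addE b a)).
by move=> n [-> ->]; rewrite addrC.
Qed.

Lemma germ_add0 : left_id germ_zero germ_add.
Proof.
move=> a; apply: germ_eq.
apply: eventually_imp (eventuallyI (germ_addE germ_zero a) (germ_of_repr compatible0)).
by move=> n [-> ->]; rewrite add0r.
Qed.

Lemma germ_addN : left_inverse germ_zero germ_opp germ_add.
Proof.
move=> a; apply: germ_eq; apply: eventually_imp (eventuallyI (germ_addE (germ_opp a) a)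
  (eventuallyI (germ_of_repr (compatibleN a)) (germ_of_repr compatible0))).
by move=> n [-> [-> ->]]; rewrite addNr.
Qed.

HB.instance Definition _ :=
  GRing.isZmodule.Build germ germ_addA germ_addC germ_add0 germ_addN.

End Germ.

Lemma compatible_comp W V (g : mor V W) (x : forall n, mor W (X n)) :
  eventually_compatible x -> eventually_compatible (fun n => x n ∘ g).
Proof. by apply: eventually_imp => n ->; rewrite mcompA. Qed.

Definition germ_map W V (g : mor V W) (a : germ W) : germ V :=
  germ_of (compatible_comp g (germ_repr_compatible a)).

Lemma germ_mapE W V (g : mor V W) (a : germ W) :
  eveq (germ_repr (germ_map g a)) (fun n => germ_repr a n ∘ g).
Proof. exact: germ_of_repr. Qed.

Lemma germ_map_zmod_morphism W V (g : mor V W) : zmod_morphism (germ_map g).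
Proof.
move=> a b; apply: germ_eq; apply: eventually_imp (eventuallyI (eventuallyI
    (germ_mapE g (a - b)) (germ_addE (germ_map g a) (- germ_map g b)))
  (eventuallyI (eventuallyI (germ_addE a (- b)) (germ_of_repr (compatibleN b)))
  (eventuallyI (germ_of_repr (compatibleN (germ_map g b)))
     (eventuallyI (germ_mapE g a) (germ_mapE g b))))).
move=> n [[-> ->] [[-> ->] [-> [-> ->]]]].
by rewrite mcompDl compNm.
Qed.

HB.instance Definition _ W V (g : mor V W) :=
  GRing.isZmodMorphism.Build (germ W) (germ V) (germ_map g) (germ_map_zmod_morphism g).

Lemma germ_map1 W (a : germ W) : germ_map (idm W) a = a.
Proof.
by apply: germ_eq; apply: eventually_imp (germ_mapE (idm W) a) => n ->; rewrite mcompm1.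
Qed.

Lemma germ_mapM W V U (g : mor V W) (h : mor U V) (a : germ W) :
  germ_map (g ∘ h) a = germ_map h (germ_map g a).
Proof.
apply: germ_eq; apply: eventually_imp (eventuallyI (germ_mapE (g ∘ h) a)
  (eventuallyI (germ_mapE h (germ_map g a)) (germ_mapE g a))).
by move=> n [-> [-> ->]]; rewrite mcompA.
Qed.

Lemma germ_mapD W V (g h : mor V W) (a : germ W) :
  germ_map (g + h) a = germ_map g a + germ_map h a.
Proof.
apply: germ_eq; apply: eventually_imp (eventuallyI (germ_mapE (g + h) a)
  (eventuallyI (germ_addE (germ_map g a) (germ_map h a))
  (eventuallyI (germ_mapE g a) (germ_mapE h a)))).
by move=> n [-> [-> [-> ->]]]; rewrite mcompDr.
Qed.

Definition colimit_functor : abFunctor (opCat C) :=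
  @AbFunctor (opCat C) (fun W : C => germ W)
    (fun (W V : C) (g : @mor C V W) => germ_map g) germ_map1
    (fun W V U h g a => germ_mapM g h a) germ_mapD.

End SequentialColimit.

Lemma compatible_extension (C : preaddCat) (W : C) n (X : nat -> C)
    (f : forall k, mor (X k) (X k.+1)) (g : mor W (X n)) :
  exists x : forall k, mor W (X k),
    x n = g /\ forall k, (n <= k)%N -> x k.+1 = f k ∘ x k.
Proof.
elim: n X f g => [|n IH] X f g.
  by exists (fun k => comp_seq f k ∘ g); split=> [|k _] /=; rewrite ?mcomp1m // mcompA.
have [x [xn xS]] := IH (fun k => X k.+1) (fun k => f k.+1) g.
(* Each induction step prepends one stage, filled with the default 0; only the stages from [n] on
   matter. *)
by exists (fun k => if k is j.+1 then x j else 0); split=> // -[|k] // /xS.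
Qed.

(** The projections are indexed by all of [I], so that they form an element of a direct sum of
    representable functors at [P]. *)
Lemma finite_product (C : preaddCat) (I : eqType) (Y : I -> C) (l : seq I) :
  additive_category C ->
  exists P (pr : forall i, mor P (Y i)),
    [/\ forall i, i \notin l -> pr i = 0,
        forall W (d : forall i, mor W (Y i)), exists a, forall i, i \in l -> pr i ∘ a = d i
      & forall W (g g' : mor W P), (forall i, i \in l -> pr i ∘ g = pr i ∘ g') -> g = g'].
Proof.
move=> [[O O0] biprod]; elim: l => [|k l [P [pr [pr0 prE pr_inj]]]].
  exists O, (fun i => 0); split=> // [W d|W g g' _]; first by exists 0.
  by rewrite -(mcomp1m g) -(mcomp1m g') O0 !comp0m.
have [kl|nkl] := boolP (k \in l).
  have lE i : (i \in k :: l) = (i \in l).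
    by rewrite inE; case: eqP => // ->; rewrite kl.
  exists P, pr; split=> [i|W d|W g g' gg']; first by rewrite lE; apply: pr0.
    by have [a ad] := prE W d; exists a => i; rewrite lE; apply: ad.
  by apply: pr_inj => i il; apply: gg'; rewrite lE.
have [Q [u [j [p [q [pu qj qu pj upjq]]]]]] := biprod (Y k) P.
pose pr' i : mor Q (Y i) :=
  match pselect (k = i) with
  | left e => eq_rect k (fun i => mor Q (Y i)) p i e
  | right _ => pr i ∘ q
  end.
have prk : pr' k = p.
  by rewrite /pr'; case: pselect => // e; rewrite (Prop_irrelevance e erefl).
have prl i : k <> i -> pr' i = pr i ∘ q by rewrite /pr'; case: pselect.
have l_neq i : i \in l -> k <> i by move=> il ki; rewrite ki il in nkl.
exists Q, pr'; split=> [i|W d|W g g' gg'].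
- rewrite inE negb_or => /andP[/eqP ik il]; rewrite prl; last by move=> ki; apply: ik.
  by rewrite pr0 // comp0m.
- have [a ad] := prE W d; exists (u ∘ d k + j ∘ a) => i; rewrite inE => /orP[/eqP->|il].
    by rewrite prk mcompDr !mcompA pu pj mcomp1m comp0m addr0.
  rewrite prl; last exact: l_neq.
  by rewrite -mcompA mcompDr !mcompA qu qj mcomp1m comp0m add0r ad.
- have pg : p ∘ g = p ∘ g' by rewrite -prk; apply: gg'; rewrite inE eqxx.
  have qg : q ∘ g = q ∘ g'.
    apply: pr_inj => i il; rewrite !mcompA -prl; last exact: l_neq.
    by apply: gg'; rewrite inE il orbT.
  by rewrite -(mcomp1m g) -(mcomp1m g') -upjq !mcompDl -!mcompA pg qg.
Qed.

(** * From local noetherianity to Bass' condition *)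

Section BassCondition.
Variable T : triData.

(* In terms of T, the triangle (f, g, h) of the opposite category consists of
   maps Z -g-> Y -f-> X. *)
Hypothesis T_exact : forall (X Y Z : opTri T) (f : mor X Y) (g : mor Y Z)
    (h : mor Z (Σ X)) (W : T) (y : @mor T Y W),
  exact_triangle f g h ->
  y ∘ (g : @mor T Z Y) = 0 <-> exists x : @mor T X W, x ∘ (f : @mor T Y X) = y.

(** A relation between germs already holds at some stage [N]; exactness of Hom(-, [X N]) yields a
    preimage there, and pushing it forward along [f] defines a germ. *)
Lemma colimit_cohomological (X : nat -> T) (f : forall n, mor (X n) (X n.+1)) :
  cohomological (T := opTri T) (colimit_functor f).
Proof.
move=> A B D u v h tri y; split=> [|[x <-]]; last first.
  change (germ_map (v : @mor T D B) (germ_map (u : @mor T B A) x) = 0).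
  apply: germ_eq; apply: eventually_imp (eventuallyI
    (germ_mapE (v : @mor T D B) (germ_map (u : @mor T B A) x))
    (eventuallyI (germ_mapE (u : @mor T B A) x) (germ_of_repr (compatible0 f D)))).
  by move=> n [-> [-> ->]]; apply/(T_exact _ tri); eexists.
change (germ_map (v : @mor T D B) y = 0 ->
  exists x : germ f A, germ_map (u : @mor T B A) x = y) => vy.
have yv : eventually (fun n => germ_repr y n ∘ (v : @mor T D B) = 0).
  have := eventuallyI (germ_mapE (v : @mor T D B) y) (germ_of_repr (compatible0 f D)).
  by rewrite vy; apply: eventually_imp => n [<- ->].
have [N NP] := eventuallyI yv (germ_repr_compatible y).
have [xN xNE] := proj1 (T_exact (germ_repr y N) tri) (proj1 (NP N (leqnn N))).
have [x [xN' xS]] := compatible_extension f xN.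
have cx : eventually_compatible f x by exists N.
have xy k : (N <= k)%N -> x k ∘ (u : @mor T B A) = germ_repr y k.
  elim: k => [|k IH]; first by rewrite leqn0 => /eqP N0; subst N; rewrite xN'.
  rewrite leq_eqVlt => /orP[/eqP Nk|Nk]; first by subst N; rewrite xN'.
  by rewrite xS // -mcompA IH // (proj2 (NP k Nk)).
exists (germ_of cx); apply: germ_eq.
apply: eventually_imp (eventuallyI (germ_mapE (u : @mor T B A) (germ_of cx))
  (eventuallyI (germ_of_repr cx) (ex_intro _ N xy))).
by move=> n [-> [-> <-]].
Qed.

(* The functor colim Hom(-, X n) is a direct sum of representables; since X 0 is
   compact, the canonical element over X 0 lies in a finite subsum, that is, in a
   representable direct summand. *)
Lemma locally_noetherian_bass :
  additive_category T -> locally_noetherian T -> bass T.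
Proof.
move=> addT noethT X f.
have [I [V [eta [eta_bij eta_nat]]]] := noethT _ (@colimit_cohomological X f).
have [x0 [x00 x0S]] := compatible_extension f (idm (X 0)).
have cx0 : eventually_compatible f x0 by exists 0.
have x0E n : x0 n = comp_seq f n by elim: n => //= n <-; rewrite x0S.
pose d := eta (X 0) (germ_of cx0).
have /(@finite_seqP {classic I})[l lE] := dval_finite d.
have inl (i : {classic I}) : d i <> 0 <-> i \in l.
  have e : (d i <> 0) = (i \in l :> Prop) := congr1 (fun A : I -> Prop => A i) lE.
  by rewrite e.
have [Y [pr [pr0 prE pr_inj]]] := finite_product (V : {classic I} -> T) l addT.
have pr_fin : finite_set [set i : I | pr i <> 0].
  apply: (sub_finite_set _ (dval_finite d)) => i /= pri; apply/inl.
  by apply: contra_notT pri; apply: pr0.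
(* Under [eta] the projections correspond to a germ [y] over [Y], and [a], built from the components
   of the canonical germ, pulls [y] back to that germ. *)
pose pr_sum : dsumFunctor (fun i => representable (V i)) Y := DSum pr_fin.
have [eta_inv etaK eta_invK] := eta_bij Y.
pose y : germ f Y := eta_inv pr_sum.
have [a aE] := prE _ d.
have ya : germ_map a y = germ_of cx0.
  apply: (bij_inj (eta_bij (X 0))); rewrite (eta_nat _ _ (a : @mor (opTri T) _ _)) eta_invK.
  apply: dsumP; change (forall i : {classic I}, pr i ∘ a = d i) => i.
  have [il|il] := boolP (i \in l); first exact: aE.
  rewrite pr0 // comp0m.
  by apply/esym; apply: contrapT => /inl; apply/negP.
have [n nP] := eventuallyI (germ_repr_compatible y)
  (eventuallyI (eveq_sym (germ_mapE a y)) (germ_of_repr cx0)).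
have [_ [yan x0n]] := nP n (leqnn n); rewrite ya x0n x0E in yan.
have [z [zn zS]] := compatible_extension f (idm (X n.+1)).
have cz : eventually_compatible f z by exists n.+1.
(* Here [p] collects the components of the canonical germ over [X n.+1]. This germ pulls back to [y]
   along [f n ∘ germ_repr y n], so the composite of that map with [p] has components [pr i]. *)
pose q := eta (X n.+1) (germ_of cz).
have [p pE] := prE _ q.
exists n, Y, a, (germ_repr y n), p; split; first by rewrite yan.
apply: pr_inj => i il; rewrite -mcompA (mcompA (pr i)) pE // mcompm1.
have zy : germ_map (f n ∘ germ_repr y n) (germ_of cz) = y.
  apply: germ_eq; apply: eventually_imp (eventuallyI (germ_mapE (f n ∘ germ_repr y n)
    (germ_of cz)) (eventuallyI (germ_of_repr cz) _)) => [m [-> [-> h]]|]; first exact: h.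
  exists n.+1; elim=> [//|m IH]; rewrite leq_eqVlt => /orP[/eqP nm|nm].
    by case: nm => <-; rewrite zn mcomp1m (proj1 (nP n _)).
  by rewrite zS // -mcompA IH // (proj1 (nP m _)) // ltnW // ltnW.
have := congr1 (fun t => eta Y t i) zy.
rewrite (eta_nat _ _ (f n ∘ germ_repr y n : @mor (opTri T) _ _)) eta_invK.
exact.
Qed.

End BassCondition.

(** * The suspension is fully faithful *)

Section Shift.
Variable T : triData.
Implicit Types X Y Z W : T.

Lemma emap0 (F : addEndo T) X Y : emap F (0 : mor X Y) = 0.
Proof. by apply: (addIr (emap F 0)); rewrite -emapD !add0r. Qed.

Lemma emapN (F : addEndo T) X Y (f : mor X Y) : emap F (- f) = - emap F f.
Proof. by apply: (addIr (emap F f)); rewrite -emapD !addNr emap0. Qed.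

Lemma comp_iso_eq0 X Y Z (g : mor Y Z) (f : mor X Y) : is_iso g -> g ∘ f = 0 -> f = 0.
Proof. by move=> [k [kg _]] gf; rewrite -(mcomp1m f) -kg -mcompA gf compm0. Qed.

Lemma iso_comp_eq0 X Y Z (g : mor Y Z) (f : mor X Y) : is_iso f -> g ∘ f = 0 -> g = 0.
Proof. by move=> [k [_ fk]] gf; rewrite -(mcompm1 g) -fk mcompA gf comp0m. Qed.

Lemma shift_eq0 X Y (f : mor X Y) : Σm f = 0 -> f = 0.
Proof.
by move=> f0; apply: comp_iso_eq0 (shift_unit_iso Y) _; rewrite shift_unit_nat f0 emap0 comp0m.
Qed.

Lemma unshift_eq0 X Y (f : mor X Y) : emap unshift f = 0 -> f = 0.
Proof.
move=> f0; apply: iso_comp_eq0 (shift_counit_iso X) _.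
by rewrite shift_counit_nat f0 emap0 compm0.
Qed.

(** The unit carries [unshift w] to a map from [X] to [Y]; that it suspends to [w] is checked after
    the faithful functor [unshift]. *)
Lemma shift_full X Y (w : mor (Σ X) (Σ Y)) : exists f, w = Σm f.
Proof.
have [v [vu uv]] := shift_unit_iso Y.
exists (v ∘ emap unshift w ∘ shift_unit X); apply/eqP; rewrite -subr_eq0; apply/eqP.
apply: unshift_eq0; apply: iso_comp_eq0 (shift_unit_iso X) _.
rewrite emapD emapN mcompDl compNm -shift_unit_nat.
by rewrite !mcompA uv mcomp1m subrr.
Qed.

End Shift.

(** * Weak kernels and weak cokernels from exact triangles *)

Section Triangulated.
Variables (T : triData) (T_tri : is_triangulated T).
Implicit Types X Y Z W : T.

Lemma zero_map (F : addEndo T) Z : is_zero Z -> is_zero (F Z).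
Proof. by rewrite /is_zero => Z0; rewrite -emap1 Z0 emap0. Qed.

Lemma zero_object : exists Z : T, is_zero Z.
Proof. exact: (proj1 (tri_additive T_tri)). Qed.

Lemma triangle_rot X Y Z (f : mor X Y) (g : mor Y Z) (h : mor Z (Σ X)) :
  exact_triangle f g h -> exact_triangle g h (- Σm f).
Proof. by move/(tri_rot T_tri). Qed.

Lemma triangle_comp X Y Z (f : mor X Y) (g : mor Y Z) (h : mor Z (Σ X)) :
  exact_triangle f g h -> g ∘ f = 0.
Proof.
move=> tri; have [O O0] := zero_object.
have sq : f ∘ idm X = f ∘ idm X by [].
have [w [<- _]] := tri_mor T_tri (tri_id T_tri X O0) tri sq.
by rewrite compm0.
Qed.

Lemma triangle_comp2 X Y Z (f : mor X Y) (g : mor Y Z) (h : mor Z (Σ X)) :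
  exact_triangle f g h -> h ∘ g = 0.
Proof. by move=> /triangle_rot /triangle_comp. Qed.

(** The triangle maps to the one on [idm W] with zero first object; the third component is the
    factorization. *)
Lemma triangle_weak_cokernel X Y Z (f : mor X Y) (g : mor Y Z) (h : mor Z (Σ X))
    W (y : mor Y W) :
  exact_triangle f g h -> y ∘ f = 0 -> exists x, y = x ∘ g.
Proof.
move=> tri yf; have [O O0] := zero_object.
have tri0 : exact_triangle (0 : mor O W) (idm W) (0 : mor W (Σ O)).
  by apply/(tri_rot T_tri); rewrite emap0 oppr0; apply: (tri_id T_tri); apply: zero_map.
have sq : y ∘ f = (0 : mor O W) ∘ (0 : mor X O) by rewrite yf comp0m.
have [w [wg _]] := tri_mor T_tri tri tri0 sq.
by exists w; rewrite wg mcomp1m.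
Qed.

(** A rotated triangle on [idm W] maps to the rotation of the given one; the third component, from
    [Σ W] to [Σ X], desuspends by fullness. *)
Lemma triangle_weak_kernel X Y Z (f : mor X Y) (g : mor Y Z) (h : mor Z (Σ X))
    W (y : mor W Y) :
  exact_triangle f g h -> g ∘ y = 0 -> exists x, y = f ∘ x.
Proof.
move=> tri gy; have [O O0] := zero_object.
have sq : (0 : mor O Z) ∘ (0 : mor W O) = g ∘ y by rewrite gy comp0m.
have [w [_ ws]] := tri_mor T_tri (triangle_rot (tri_id T_tri W O0)) (triangle_rot tri) sq.
have [x xw] := shift_full w; exists x.
apply/eqP; rewrite -subr_eq0; apply/eqP; apply: shift_eq0.
move: ws; rewrite xw emap1 compmN mcompm1 compNm => /oppr_inj.
by rewrite emapD emapN emapM => ->; rewrite subrr.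
Qed.

Lemma cocone Y Z (g : mor Y Z) :
  exists X (f : mor X Y) (h : mor Z (Σ X)), exact_triangle f g h.
Proof.
have [D [k [l tri]]] := tri_cone T_tri g.
have [c [cK Kc]] := shift_counit_iso D.
have [f fE] := shift_full (l ∘ shift_counit D).
(* The sign of [f] cancels the one in the rotation axiom. *)
exists (unshift D), (- f), (c ∘ k); apply/(tri_rot T_tri); rewrite emapN opprK.
apply: (tri_iso T_tri (u := idm Y) (v := idm Z) (w := c) (is_iso_id _) (is_iso_id _) _ _ _ _ tri).
- by exists (shift_counit D).
- by rewrite mcomp1m mcompm1.
- by rewrite mcompm1.
- by rewrite emap1 mcomp1m -fE -mcompA Kc mcompm1.
Qed.

Lemma triangulated_weak_cokernels : weak_cokernels T.
Proof.
move=> P X g; have [D [c [h tri]]] := tri_cone T_tri g; exists D, c; split.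
- exact: triangle_comp tri.
- by move=> W y; apply: triangle_weak_kernel tri.
- by move=> W y; apply: triangle_weak_cokernel tri.
Qed.

Lemma triangulated_weak_kernels : weak_cokernels (opCat T).
Proof.
move=> P X g; have [D [c [h tri]]] := cocone (g : @mor T X P); exists D, c; split.
- exact: triangle_comp tri.
- by move=> W y; apply: (triangle_weak_cokernel (y := y : @mor T X W) tri).
- by move=> W y; apply: (triangle_weak_kernel (y := y : @mor T W X) tri).
Qed.

Lemma opCat_additive (C : preaddCat) : additive_category C -> additive_category (opCat C).
Proof.
move=> [[O O0] biprod]; split; first by exists O.
move=> X Y; have [P [i [j [p [q [pi qj qi pj ipjq]]]]]] := biprod X Y.
by exists P, p, q, i, j; split.
Qed.

Lemma triangulated_bass : locally_noetherian T -> bass T.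
Proof.
apply: locally_noetherian_bass (tri_additive T_tri).
move=> X Y Z f g h W y [h' [_ tri]]; split=> [yg|[x <-]].
  by have [x ->] := triangle_weak_cokernel tri yg; exists x.
by rewrite -mcompA (triangle_comp tri) compm0.
Qed.

Lemma triangulated_bass_op : locally_noetherian (opTri T) -> bass (opCat T).
Proof.
apply: (@locally_noetherian_bass (opTri T)); last exact: opCat_additive (tri_additive T_tri).
(* Taking opposites twice, the nested existentials of [opTri] return an exact triangle of [T] on [f]
   and [g] in their original order. *)
move=> X Y Z f g h W y [h' [_ [h'' [_ tri]]]].
change (exact_triangle (f : @mor T X Y) (g : @mor T Y Z) h'') in tri.
split=> [gy|[x <-]].
  have [x ->] := triangle_weak_kernel tri (gy : (g : @mor T Y Z) ∘ (y : @mor T W Y) = 0).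
  by exists x.
change ((g : @mor T Y Z) ∘ ((f : @mor T X Y) ∘ (x : @mor T W X)) = 0).
by rewrite mcompA (triangle_comp tri) comp0m.
Qed.

End Triangulated.

(** * Closure properties of thick subcategories *)

Section Thick.
Variables (T : triData) (T_tri : is_triangulated T).
Implicit Types X Y Z W A B D E : T.

Section Closure.
Variables (S : subcategory T) (S_thick : thick S).

Lemma thick_zero O : is_zero O -> S O.
Proof.
have [[[X SX] _ _ _] summand] := S_thick; move=> O0; apply: summand SX.
exists X, 0, (idm X), 0, (idm X); split; rewrite ?mcomp1m ?mcompm1 ?comp0m ?compm0 //.
by rewrite add0r.
Qed.

Lemma thick_iso X Y : isomorphic X Y -> S Y -> S X.
Proof.
move=> [f [g [gf fg]]]; apply: (proj2 S_thick); have [O O0] := zero_object T_tri.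
exists O, f, 0, g, 0; split; rewrite ?comp0m ?compm0 ?addr0 //.
Qed.

(** Idempotents split, so [idm Y - s ∘ r] provides a complement of [X] in [Y]. *)
Lemma thick_retract X Y (s : mor X Y) (r : mor Y X) :
  bass T -> r ∘ s = idm X -> S Y -> S X.
Proof.
move=> bassT rs; apply: (proj2 S_thick).
have e_idem : (s ∘ r) ∘ (s ∘ r) = s ∘ r by rewrite -mcompA (mcompA r) rs mcomp1m.
have [|X' [s' [r' [rs' sr']]]] := splits_idempotent (e := idm Y - s ∘ r) bassT.
  by rewrite mcompDl mcomp1m compNm mcompDr mcompm1 compmN e_idem subrr subr0.
have r's : r' ∘ s = 0.
  rewrite -(mcomp1m r') -rs' -!mcompA (mcompA s') sr' mcompDl compNm mcomp1m.
  by rewrite -mcompA rs mcompm1 subrr compm0.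
have rs'0 : r ∘ s' = 0.
  rewrite -(mcompm1 s') -rs' (mcompA s') sr' mcompA mcompDr compmN mcompm1.
  by rewrite mcompA rs mcomp1m subrr comp0m.
by exists X', s, s', r, r'; split; rewrite ?sr' // addrC subrK.
Qed.

(** The cone of the split mono [i] has connecting map [h = 0] and is therefore isomorphic to [Y]. *)
Lemma thick_biproduct X Y P (i : mor X P) (j : mor Y P) (p : mor P X) (q : mor P Y) :
  is_biproduct i j p q -> S X -> S Y -> S P.
Proof.
move=> [pi qj qi pj ipjq] SX SY; have [D [c [h tri]]] := tri_cone T_tri i.
have [[_ _ _ two3] _] := S_thick; have [_ _] := two3 _ _ _ _ _ _ tri; apply => //.
apply: thick_iso SY; have [t qE] := triangle_weak_cokernel T_tri tri qi.
exists t, (c ∘ j); split; last by rewrite mcompA -qE.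
have cjt : (c ∘ j ∘ t - idm D) ∘ c = 0.
  rewrite mcompDl compNm mcomp1m -mcompA -qE -mcompA -[X in _ - X]mcompm1 -ipjq.
  by rewrite mcompDr !mcompA (triangle_comp T_tri tri) comp0m add0r subrr.
have [u uE] := triangle_weak_cokernel T_tri (triangle_rot T_tri tri) cjt.
have h0 : h = 0.
  have ih := triangle_comp2 T_tri (triangle_rot T_tri tri).
  rewrite -(mcomp1m h) -emap1 -pi emapM -mcompA -[_ ∘ h]opprK -compNm ih.
  by rewrite oppr0 compm0.
by apply/eqP; rewrite -subr_eq0 uE h0 compm0.
Qed.

End Closure.

Definition generated_by (I : Type) (P : I -> Prop) (L : I -> T) : subcategory T :=
  fun Y => forall S : subcategory T, thick S -> (forall i, P i -> S (L i)) -> S Y.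

Lemma generated_by_thick (I : Type) (P : I -> Prop) (L : I -> T) :
  thick (generated_by P L).
Proof.
have [O O0] := zero_object T_tri; split; first split.
- by exists O => S S_thick _; apply: thick_zero.
- by move=> X genX S S_thick SL; apply: (tsub_shift (proj1 S_thick)); apply: genX.
- by move=> X genX S S_thick SL; apply: (tsub_unshift (proj1 S_thick)); apply: genX.
- move=> X Y Z f g h tri; split=> gen1 gen2 S S_thick SL;
    have [two1 two2 two3] := tsub_two_of_three (proj1 S_thick) tri;
    [apply: two1|apply: two2|apply: two3]; by [apply: gen1|apply: gen2].
- by move=> X Y XY genY S S_thick SL; apply: (proj2 S_thick) XY _; apply: genY.
Qed.

(** * Right approximations by a thick subcategory *)

Section Approximation.
Variables (G : subcategory T) (G_thick : thick G).
Hypotheses (bassT : bass T) (noethT : noetherian T).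

Definition approximation A Y (g : mor Y A) : Prop :=
  forall Y' (g' : mor Y' A), G Y' -> exists x, g' = g ∘ x.

(** Take a source [Y] none of whose proper retracts is the source of an approximation from [G]. If
    [g ∘ h = g], Bass' condition for the powers of [h] gives a retract of [Y] on which [g] is still
    an approximation, and this must be all of [Y]. *)
Lemma minimal_approximation A :
  exists Y (g : mor Y A), [/\ G Y, approximation g
    & forall h : mor Y Y, g ∘ h = g -> exists k, k ∘ h = idm Y].
Proof.
have [||Y0 [g0 [GY0 g0P]]] := @noethT A (fun Y _ => G Y).
- by have [O O0] := zero_object T_tri; exists O, 0; apply: thick_zero O0.
- by move=> Y1 Y2 P i j p q _ _ bip GY1 GY2; apply: thick_biproduct bip GY1 GY2.
have [Y [GY [g gP]] Ymin] := minimal_element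
  (P := fun Y => G Y /\ exists g : mor Y A, approximation g)
  (fun s => proper_retract_wf s bassT)
  (conj GY0 (ex_intro (fun g => approximation g) g0 (fun Y' g' => g0P Y' g'))).
exists Y, g; split=> // h gh.
have [n [Z [a [s [p [hE phs]]]]]] := bassT (fun=> h).
have gsa : g ∘ s ∘ a = g.
  rewrite -mcompA -hE; elim: {a s p hE phs} n => [|n IH] /=; first by rewrite mcompm1.
  by rewrite mcompA gh.
have GZ : G Z by apply: (thick_retract G_thick bassT phs).
have s_iso : is_iso s.
  apply: contrapT => ns; apply: (Ymin Z); last by exists s, (p ∘ h).
  split=> //; exists (g ∘ s) => Y' g' /(gP _ g')[x ->]; exists (a ∘ x).
  by rewrite mcompA gsa.
by exists (s ∘ p); rewrite -mcompA (is_iso_splitmono s_iso phs).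
Qed.

(* Wakamatsu's argument: pull the triangle back along D -> B to an extension E of D
   by Y, which lies in G; by minimality Y splits off E, so D -> B lifts to A. *)
Lemma approximation_triangle A :
  exists Y B (g : mor Y A) (b : mor A B) (d : mor B (Σ Y)),
    [/\ exact_triangle g b d, G Y & forall D (u : mor D B), G D -> u = 0].
Proof.
have [Y [g [GY gP gmin]]] := minimal_approximation A.
have [B [b [d tri]]] := tri_cone T_tri g.
exists Y, B, g, b, d; split=> // D u GD.
have [E [e [k triE]]] := cocone T_tri (d ∘ u).
have [k' kE] := shift_full (- k).
have {}triE : exact_triangle k' e (d ∘ u).
  by apply/(tri_rot T_tri); rewrite -kE opprK.
have GE : G E by have [_ _] := tsub_two_of_three (proj1 G_thick) triE; apply.
have sq : idm (Σ Y) ∘ (d ∘ u) = d ∘ u by rewrite mcomp1m.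
have rot2 := fun X Y Z f g h t => triangle_rot T_tri (@triangle_rot T T_tri X Y Z f g h t).
have [w [wk _]] := tri_mor T_tri (rot2 _ _ _ _ _ _ triE) (rot2 _ _ _ _ _ _ tri) sq.
have [v vE] := shift_full w.
have vk : v ∘ k' = g.
  apply/eqP; rewrite -subr_eq0; apply/eqP; apply: shift_eq0; rewrite emapD emapN emapM -vE.
  by move: wk; rewrite compmN compNm mcompm1 => /oppr_inj ->; rewrite subrr.
have [phi phiE] := gP E v GE.
have [psi psiE] : exists psi, psi ∘ (phi ∘ k') = idm Y.
  by apply: gmin; rewrite mcompA -phiE.
have du : d ∘ u = 0.
  rewrite -(mcomp1m (d ∘ u)) -emap1 -psiE (mcompA psi) emapM -mcompA.
  have := triangle_comp2 T_tri (triangle_rot T_tri triE).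
  by rewrite compNm => /eqP; rewrite oppr_eq0 => /eqP ->; rewrite compm0.
have [u' ->] := triangle_weak_kernel T_tri (triangle_rot T_tri tri) du.
(* The lift [u'] starts in [G], so it factors through the approximation [g], which [b] kills. *)
have [u'' ->] := gP D u' GD.
by rewrite mcompA (triangle_comp T_tri tri) comp0m.
Qed.

End Approximation.

(** Shifts of the source move to the target, where [O] is stable; weak cokernels give two out of
    three. *)
Lemma orthogonal_thick (O : subcategory T) :
  (forall B, O B -> O (Σ B)) -> (forall B, O B -> O (unshift B)) ->
  thick (fun Z => forall B, O B -> forall f : mor Z B, f = 0).
Proof.
move=> Oshift Ounshift.
have cone0 X Y Z (f : mor X Y) (g : mor Y Z) (h : mor Z (Σ X)) B (y : mor Z B) :
    exact_triangle f g h -> y ∘ g = 0 -> (forall x : mor (Σ X) B, x = 0) -> y = 0.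
  move=> tri yg X0; have [x ->] := triangle_weak_cokernel T_tri (triangle_rot T_tri tri) yg.
  by rewrite (X0 x) comp0m.
have sh X : (forall B, O B -> forall f : mor X B, f = 0) ->
    forall B, O B -> forall f : mor (Σ X) B, f = 0.
  move=> X0 B OB f; apply: unshift_eq0; apply: iso_comp_eq0 (shift_unit_iso X) _.
  by apply: X0; apply: Ounshift.
have unsh X : (forall B, O B -> forall f : mor (Σ X) B, f = 0) ->
    forall B, O B -> forall f : mor X B, f = 0.
  by move=> X0 B OB f; apply: shift_eq0; apply: X0; apply: Oshift.
split; first split.
- by have [Z Z0] := zero_object T_tri; exists Z => B _ f; rewrite -(mcompm1 f) Z0 compm0.
- exact: sh.
- move=> X X0 B OB f; apply: shift_eq0; have [c [cK Kc]] := shift_counit_iso X.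
  apply: (iso_comp_eq0 (f := c)); first by exists (shift_counit X).
  by apply: X0; apply: Oshift.
- move=> X Y Z f g h tri; split=> [X0 Y0|Y0 Z0|X0 Z0].
  + move=> B OB y; apply: cone0 tri _ _; first exact: Y0.
    exact: sh X0 B OB.
  + apply: unsh => B OB y; apply: cone0 (triangle_rot T_tri tri) _ _; first exact: Z0.
    exact: sh Y0 B OB.
  + move=> B OB y; have [x ->] := triangle_weak_cokernel T_tri tri (X0 B OB (y ∘ f)).
    by rewrite (Z0 B OB x) comp0m.
- move=> X Y [X' [i [j [p [q [pi _ _ _ _]]]]]] Y0 B OB f.
  by rewrite -(mcompm1 f) -pi mcompA (Y0 B OB (f ∘ p)) comp0m.
Qed.

(** * Recovering a thick subcategory from finitely many indecomposables *)

Lemma thick_generated (X : T) (I : finType) (L : I -> T) (S : subcategory T) :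
  bass T -> noetherian T -> (forall Y, Thick X Y) ->
  (forall Y, indecomposable Y -> (exists g : mor X Y, g <> 0) ->
    exists i, isomorphic Y (L i)) ->
  thick S -> S = generated_by (fun i => S (L i)) L.
Proof.
move=> bassT noethT Xgen LP S_thick; set G := generated_by _ _.
have G_thick : thick G by apply: generated_by_thick.
have GS Y : G Y -> S Y by apply.
apply: funext => A; apply: propext; split; last exact: GS.
move=> SA; have [Y [B [g [b [d [tri GY B_orth]]]]]] :=
  approximation_triangle G_thick bassT noethT A.
pose O B := S B /\ forall D (u : mor D B), G D -> u = 0.
have OB : O B.
  split=> //; have [two1 _ _] := tsub_two_of_three (proj1 S_thick) tri.
  by apply: two1; first exact: GS.
have Oshift D : O D -> O (Σ D).
  move=> [SD Dorth]; split; first exact: (tsub_shift (proj1 S_thick)).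
  move=> D' u GD'; apply: unshift_eq0; have [v [vK Kv]] := shift_unit_iso D.
  apply: (comp_iso_eq0 (g := v)); first by exists (shift_unit D).
  by apply: Dorth; apply: (tsub_unshift (proj1 G_thick)).
have Ounshift D : O D -> O (unshift D).
  move=> [SD Dorth]; split; first exact: (tsub_unshift (proj1 S_thick)).
  move=> D' u GD'; apply: shift_eq0; apply: comp_iso_eq0 (shift_counit_iso D) _.
  by apply: Dorth; apply: (tsub_shift (proj1 G_thick)).
have XO : forall D, O D -> forall f : mor X D, f = 0.
  move=> D [SD Dorth] f; have [J [Z [s [r [indZ rs sr]]]]] := all_decompose D bassT.
  rewrite -(mcomp1m f) -sr comp_suml big1 // => j _; rewrite -mcompA.
  apply: contrapT => srf; have [|i Zi] := LP (Z j) (indZ j).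
    by exists (r j ∘ f) => rf; apply: srf; rewrite rf compm0.
  have SZ : S (Z j) := thick_retract S_thick bassT (rs j) SD.
  have GZ : G (Z j).
    apply: (thick_iso G_thick Zi) => S' S'_thick; apply.
    exact: (thick_iso S_thick) (isomorphic_sym Zi) SZ.
  by apply: srf; rewrite (Dorth _ (s j) GZ) comp0m.
(* The left orthogonal of [O] is thick and contains the generator [X], hence contains [B], which
   itself lies in [O]. *)
have B0 : is_zero B := Xgen B _ (orthogonal_thick Oshift Ounshift) XO B OB (idm B).
have [_ _ two3] := tsub_two_of_three (proj1 G_thick) tri; apply: two3 => //.
exact: thick_zero.
Qed.

End Thick.

Theorem proposition4p5 (T : triData) (T_tri : is_triangulated T)
    (T_small : essentially_small T) :
  finitely_generated T -> locally_finite T ->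
  finitely_many_thick T.
Proof.
move=> [X Xgen] [noethT noethT_op].
have addT := tri_additive T_tri.
have bassT := triangulated_bass T_tri noethT.
have bassT_op := triangulated_bass_op T_tri noethT_op.
have noeth : noetherian T.
  exact: bass_noetherian bassT addT (triangulated_weak_cokernels T_tri).
have noeth_op : noetherian (opCat T).
  exact: bass_noetherian bassT_op (opCat_additive addT) (triangulated_weak_kernels T_tri).
(* Maps to [X] in the opposite category are the maps of [T] starting in [X]. *)
have [I [L LP]] := finite_indecomposables (X : opCat T) bassT_op bassT noeth_op (zero_object T_tri).
have {}LP Y : indecomposable Y -> (exists g : mor X Y, g <> 0) -> exists i, isomorphic Y (L i).
  move=> indY Y0; have [|i [f [g [gf fg]]]] := LP Y; first by split.
  by exists i, (g : @mor T Y (L i)), (f : @mor T (L i) Y).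
(* One candidate for each set of indices; different sets may generate the same subcategory. *)
exists #|{set I}|, (fun k => generated_by (fun i => i \in (enum_val k : {set I})) L) => S.
split=> [S_thick|[k ->]]; last exact: generated_by_thick.
exists (enum_rank [set i | `[< S (L i) >]]); rewrite enum_rankK.
rewrite [LHS](thick_generated T_tri bassT noeth Xgen LP S_thick); congr generated_by.
by apply: funext => i; apply: propext; rewrite inE; split=> /asboolP.
Qed.
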